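(* Let $n\in\mathbb{N}$. A set $S\subseteq\mathbb{R}^n$ is MICP representable if and only if there exist $d,p\in\mathbb{N}$, a convex set $C\subseteq\mathbb{R}^d$ and a closed convex family $(B_z)_{z\in C}$ in $\mathbb{R}^{n+p}$ such that $S=\bigcup_{z\in C\cap\mathbb{Z}^d}\operatorname{proj}_x(B_z)$.
   Context: $\mathbb{N}=\{0,1,2,\dots\}$. For a set in $\mathbb{R}^{n+p+d}$ (or $\mathbb{R}^{n+p}$) with variables $(x,y,z)\in\mathbb{R}^n\times\mathbb{R}^p\times\mathbb{R}^d$ (or $(x,y)$), $\operatorname{proj}_x$ denotes its projection onto the $x\in\mathbb{R}^n$ variables. MICP representability: $S\subseteq\mathbb{R}^n$ is MICP representable if there exist $p,d\in\mathbb{N}$ and a closed convex set $M\subseteq\mathbb{R}^{n+p+d}$ such that $S=\operatorname{proj}_x\big(M\cap(\mathbb{R}^{n+p}\times\mathbb{Z}^d)\big)$. Convex family: let $C\subseteq\mathbb{R}^d$ be a convex set and $(A_z)_{z\in C}$ a family of convex sets in $\mathbb{R}^N$. The family is convex if for all $z,z'\in C$ and $\lambda\in[0,1]$, $\lambda A_z+(1-\lambda)A_{z'}\subseteq A_{\lambda z+(1-\lambda)z'}$. The family is moreover closed if $A_z$ is closed for all $z\in C$ and for any convergent sequences $(z_m)_{m\in\mathbb{N}}$, $(x_m)_{m\in\mathbb{N}}$ with $z_m\in C$, $x_m\in A_{z_m}$ and $\lim_{m\to\infty}z_m\in C$, we have $\lim_{m\to\infty}x_m\in A_{\lim_{m\to\infty}z_m}$.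 *)

(* Defs.v *)
From HB Require Import structures.
From mathcomp Require Import all_boot all_order all_algebra.
From mathcomp Require Import boolp classical_sets functions reals topology.
From mathcomp Require Import normedtype sequences convex.
Set Implicit Arguments.
Unset Strict Implicit.
Unset Printing Implicit Defensive.
Import Order.TTheory GRing.Theory Num.Theory.
Import numFieldNormedType.Exports.
Local Open Scope classical_set_scope.
Local Open Scope ring_scope.

(* R^k is ['rV[R]_k] with its entrywise (product) topology, which the library
   provides for every k, including k = 0. The product R^n x R^p x R^d is
   ['rV[R]_(n + (p + d))], its points being [row_mx x (row_mx y z)]. *)

Definition int_lattice (R : realType) (d : nat) : set 'rV[R]_d :=
  [set z | z \is a mxOver Num.int].
Arguments int_lattice : clear implicits.

(* [q] is the number of variables projected out: [p + d] or [p]. *)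
Definition proj_x (R : realType) (n q : nat) (A : set 'rV[R]_(n + q)) :
    set 'rV[R]_n :=
  lsubmx @` A.

Definition mixed_integer (R : realType) (n p d : nat) :
    set 'rV[R]_(n + (p + d)) :=
  [set v | int_lattice R d (rsubmx (rsubmx v))].
Arguments mixed_integer : clear implicits.

Definition MICP_representable (R : realType) (n : nat) (S : set 'rV[R]_n) :
    Prop :=
  exists (p d : nat) (M : set 'rV[R]_(n + (p + d))),
    [/\ closed M, convex_set M & S = proj_x (M `&` mixed_integer R n p d)].

(* A family indexed by C is a total function whose values outside C are
   irrelevant; the members A z may be empty. *)
Definition convex_family (R : realType) (d N : nat) (C : set 'rV[R]_d)
    (A : 'rV[R]_d -> set 'rV[R]_N) : Prop :=
  (forall z, C z -> convex_set (A z)) /\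
  (forall z z' (l : R), C z -> C z' -> 0 <= l <= 1 ->
     [set l *: a + (1 - l) *: a' | a in A z & a' in A z'] `<=`
     A (l *: z + (1 - l) *: z')).

Definition closed_convex_family (R : realType) (d N : nat) (C : set 'rV[R]_d)
    (A : 'rV[R]_d -> set 'rV[R]_N) : Prop :=
  [/\ convex_family C A,
      (forall z, C z -> closed (A z)) &
      (forall (z_ : nat -> 'rV[R]_d) (x_ : nat -> 'rV[R]_N)
              (z : 'rV[R]_d) (x : 'rV[R]_N),
         (forall m, C (z_ m)) -> (forall m, A (z_ m) (x_ m)) ->
         z_ @ \oo --> z -> x_ @ \oo --> x -> C z -> A z x)].

(* Main.v *)
Require Import Defs.
From mathcomp Require Import all_boot all_order all_algebra.
From mathcomp Require Import interval_inference ring lra.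
From mathcomp Require Import boolp classical_sets functions reals topology.
From mathcomp Require Import normedtype sequences convex.
Set Implicit Arguments.
Unset Strict Implicit.
Unset Printing Implicit Defensive.
Import Order.TTheory GRing.Theory Num.Theory.
Import numFieldNormedType.Exports.
Local Open Scope classical_set_scope.
Local Open Scope ring_scope.

(* Let G be the set of lattice points of C. The index set C need not be a
   projection of a closed convex set, but the convex hull of G is: with |z|^2
   for the height of z in G, the points of the convex hull of the lifted G,
   together with everything above them, form a closed set because the height
   grows superlinearly, so mass escaping to infinity carries no moment. Adding
   the height as a continuous variable thus keeps every limit of indices inside
   C, where the family is closed. Closedness and convexity of the lifted hull
   are read off its homogenisation, a sum of boundedly many copies of a closed
   pointed cone: the copies are bounded in number by Caratheodory. *)

(** * Convexity and closure in elementary terms *)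

Lemma convex_setP (R : realType) (V : lmodType R) (A : set V) :
  convex_set A <->
  forall (x y : V) (l : R), 0 <= l <= 1 -> A x -> A y -> A (l *: x + (1 - l) *: y).
Proof.
split=> [cA x y l /andP[l0 l1] Ax Ay|cA x y l].
  by have := cA x y (Itv01 l0 l1); rewrite !inE; apply.
rewrite !inE => Ax Ay; apply: cA => //.
by rewrite ge0 le1.
Qed.

(** Closed families are defined through sequences while [closed] is topological; points taken within
    [1 / (m + 1)] of [x] bridge the two. *)
Lemma closure_seq (R : realType) (V : normedModType R) (A : set V) (x : V) :
  closure A x ->
  exists2 x_ : nat -> V, (forall m, A (x_ m)) & x_ @ \oo --> x.
Proof.
move=> clAx.
have /choice[x_ x_P] m : exists y, A y /\ `|x - y| < m.+1%:R^-1.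
  have /clAx[y [Ay xy]] : nbhs x (ball x m.+1%:R^-1).
    by apply: nbhsx_ballx; rewrite invr_gt0.
  by exists y; split => //; rewrite -ball_normE in xy.
exists x_ => [m|]; first by case: (x_P m).
apply/cvgrPdist_lt => e e0; near=> m.
have [_ /lt_le_trans->//] := x_P m.
by apply/ltW; near: m; exact: near_infty_natSinv_lt (PosNum e0).
Unshelve. all: by end_near. Qed.

(** * The max norm on rows and on rows made of blocks *)

Section row_norm.
Context {R : realType}.

Lemma ler_entry_norm n (v : 'rV[R]_n) i : `|v 0 i| <= `|v|.
Proof.
rewrite [leRHS]/Num.norm/= mx_normrE.
exact: (le_bigmax _ (fun k : 'I_1 * 'I_n => `|v k.1 k.2|) (0, i)).
Qed.

Lemma norm_row_le n (v : 'rV[R]_n) c :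
  0 <= c -> (forall i, `|v 0 i| <= c) -> `|v| <= c.
Proof.
move=> c0 vc; rewrite [leLHS]/Num.norm/= mx_normrE.
by apply: bigmax_le => // -[i j] _ /=; rewrite ord1.
Qed.

Lemma norm_submx_le m n (v : 'rV[R]_(m + n)) c :
  `|lsubmx v| <= c -> `|rsubmx v| <= c -> `|v| <= c.
Proof.
move=> lc rc; apply: norm_row_le => [|i]; first exact: le_trans lc.
rewrite -(hsubmxK v) -(fintype.splitK i); case: (fintype.split i) => j /=.
  by rewrite row_mxEl (le_trans (ler_entry_norm _ _)).
by rewrite row_mxEr (le_trans (ler_entry_norm _ _)).
Qed.

Lemma cvg_row_mx (T : Type) (F : set_system T) (FF : Filter F) m n
    (f : T -> 'rV[R]_m) (g : T -> 'rV[R]_n) (a : 'rV[R]_m) (b : 'rV[R]_n) :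
  f @ F --> a -> g @ F --> b -> row_mx (f x) (g x) @[x --> F] --> row_mx a b.
Proof.
move=> fa gb; apply/cvgrPdist_le => e e0; near=> x.
apply: norm_submx_le; rewrite linearB/= ?row_mxKl ?row_mxKr; near: x.
  by move/cvgrPdist_le : fa; exact.
by move/cvgrPdist_le : gb; exact.
Unshelve. all: by end_near. Qed.

Lemma continuous_row_mx (T : topologicalType) m n
    (f : T -> 'rV[R]_m) (g : T -> 'rV[R]_n) x :
  {for x, continuous f} -> {for x, continuous g} ->
  {for x, continuous (fun y => row_mx (f y) (g y))}.
Proof. by move=> fx gx; exact: cvg_row_mx. Qed.

End row_norm.

(** Distinct integer points are at max-norm distance at least 1, so all points of [A] within 1/2 of
    [x] coincide, and a point of the closure is equal to them. *)
Lemma closed_sub_int_lattice (R : realType) d (A : set 'rV[R]_d) :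
  A `<=` int_lattice R d -> closed A.
Proof.
move=> AZ x clAx.
have near_x e : 0 < e -> exists2 y, A y & `|x - y| < e.
  move=> e0; have [y [Ay]] := clAx _ (nbhsx_ballx x e e0).
  by rewrite -ball_normE; exists y.
have [a Aa xa] := near_x 2^-1 ltac:(by []).
suff -> : x = a by [].
apply/eqP; rewrite -subr_eq0 -normr_le0; apply/ler_addgt0Pl => e e0.
have [b Ab] := near_x (Num.min e 2^-1) ltac:(by rewrite lt_min e0/=).
rewrite lt_min addr0 => /andP[xb xb2].
suff -> : a = b by exact: ltW.
apply/rowP => i; apply/eqP; rewrite -subr_eq0; apply: contraPT (xa) => ab0.
have Zab : a 0 i - b 0 i \is a Num.int.
  by rewrite rpredB//; [move/AZ: Aa|move/AZ: Ab] => /mxOverP; exact.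
have := norm_intr_ge1 Zab ab0.
have : `|a 0 i - b 0 i| <= `|a - b|.
  by have := ler_entry_norm (a - b) i; rewrite !mxE.
have : `|a - b| <= `|x - a| + `|x - b|.
  by rewrite (distrC x a) (le_trans _ (ler_normD _ _))// addrA subrK.
by move=> *; lra.
Qed.

(** * Sums of boundedly many elements of a cone: Caratheodory and closedness *)

Section conic_sums.
Context {R : realType} {k : nat}.
Implicit Types (A B Q : set 'rV[R]_k) (h : 'rV[R]_k -> R).

(** For [Q] stable under nonnegative scaling, these are the conic combinations of [m] points of [Q],
    the coefficients being absorbed into the points. *)
Definition conic_sum Q m : set 'rV[R]_k :=
  [set v | exists2 f : 'I_m -> 'rV[R]_k, (forall i, Q (f i)) & v = \sum_i f i].

Lemma conic_sumS Q m :
  conic_sum Q m.+1 = [set a + b | a in conic_sum Q m & b in Q].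
Proof.
apply/seteqP; split=> v.
  case=> f Qf ->; rewrite big_ord_recr /=.
  by exists (\sum_(i < m) f (widen_ord (leqnSn m) i));
    [exists (fun i => f (widen_ord (leqnSn m) i))|exists (f ord_max)].
case=> _ [f Qf ->] [b Qb <-].
exists (fun i => if unlift ord_max i is Some j then f j else b) => [i|].
  by case: unliftP.
rewrite big_ord_recr /= unlift_none; congr (_ + _).
apply: eq_bigr => i _.
have -> : widen_ord (leqnSn m) i = lift ord_max i by apply/val_inj => /=; rewrite /bump leqNgt ltn_ord.
by rewrite liftK.
Qed.

Lemma conic_sumD Q m n a b :
  conic_sum Q m a -> conic_sum Q n b -> conic_sum Q (m + n) (a + b).
Proof.
move=> Qa; elim: n b => [|n IH] b.
  by case=> f _ ->; rewrite big_ord0 addr0 addn0.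
rewrite conic_sumS => -[c Qc [e Qe <-]].
by rewrite addnS conic_sumS addrA; exists (a + c); [exact: IH|exists e].
Qed.

Lemma conic_sumZ Q m l a :
  (forall l v, 0 <= l -> Q v -> Q (l *: v)) ->
  0 <= l -> conic_sum Q m a -> conic_sum Q m (l *: a).
Proof.
move=> QZ l0 [f Qf ->]; exists (fun i => l *: f i) => [i|]; first exact: QZ.
by rewrite scaler_sumr.
Qed.

(* Conic Caratheodory: if [\sum_i u_i f_i = 0] with [u_j > 0] maximal, then
   [\sum_i f_i = \sum_i (1 - u_i / u_j) f_i], whose [j]-th term vanishes. *)
Lemma conic_sum_reduce Q m : (forall l v, 0 <= l -> Q v -> Q (l *: v)) ->
  (k <= m)%N -> conic_sum Q m.+1 `<=` conic_sum Q m.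
Proof.
move=> QZ km _ [f Qf ->].
pose A := \matrix_i f i.
(* More than [k] rows of length [k] are dependent; a nonzero row of the left kernel is the
   relation. *)
have /rowV0Pn[w /sub_kermxP wA w0] : kermx A != 0.
  by rewrite kermx_eq0 -row_leq_rank -ltnNge (leq_ltn_trans (rank_leq_col _)).
have [u uf [i0 ui0]] :
    exists2 u : 'I_m.+1 -> R, \sum_i u i *: f i = 0 & exists i, 0 < u i.
  have wf : \sum_i w 0 i *: f i = 0.
    rewrite -[RHS]wA mulmx_sum_row; apply: eq_bigr => i _.
    by rewrite rowK.
  have [i wi0] : exists i, w 0 i != 0.
    apply/existsP; apply: contraNT w0; rewrite negb_exists => /forallP w0.
    by apply/eqP/rowP => i; rewrite mxE; apply/eqP; rewrite -[_ == _]negbK.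
  (* A relation may be negated, so some coefficient can be taken positive. *)
  have [wi_lt0|wi_gt0|/eqP] := ltgtP (w 0 i) 0; last by rewrite (negbTE wi0).
    exists (fun i => - w 0 i); last by exists i; rewrite oppr_gt0.
    under eq_bigr do rewrite scaleNr.
    by rewrite sumrN wf oppr0.
  by exists (w 0) => //; exists i.
have [j _ uj] := @arg_maxP _ _ _ i0 xpredT u isT.
have uj0 : 0 < u j by apply: lt_le_trans ui0 _; exact: uj.
exists (fun i => (1 - u (lift j i) / u j) *: f (lift j i)) => [i|].
  by apply: QZ => //; rewrite subr_ge0 ler_pdivrMr ?mul1r//; exact: uj.
transitivity (\sum_i (1 - u i / u j) *: f i).
  under [RHS]eq_bigr do rewrite scalerBl scale1r mulrC -scalerA.
  by rewrite sumrB -scaler_sumr uf scaler0 subr0.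
by rewrite (bigD1_ord j)//= divff ?gt_eqF// subrr scale0r add0r.
Qed.

Lemma conic_sum_dim Q m : (forall l v, 0 <= l -> Q v -> Q (l *: v)) ->
  conic_sum Q (k + m) `<=` conic_sum Q k.
Proof.
move=> QZ; elim: m => [|m IH]; first by rewrite addn0.
by rewrite addnS => v /conic_sum_reduce => /(_ QZ (leq_addr _ _)) /IH.
Qed.

(** The sum has [k + k] terms, which Caratheodory cuts back to [k]: the [k]-fold sums form a convex
    cone. *)
Lemma conic_sum_dimD Q a b : (forall l v, 0 <= l -> Q v -> Q (l *: v)) ->
  conic_sum Q k a -> conic_sum Q k b -> conic_sum Q k (a + b).
Proof. by move=> QZ Qa Qb; apply: (@conic_sum_dim Q k) => //; exact: conic_sumD. Qed.

(** Since [h] is additive and dominates the norm on both sets, large terms cannot cancel: a sum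
    close to [p] has [h] below [h p + 1], which bounds each term. Near [p] only the sum of two
    compact sets matters, and that is closed. *)
Lemma closed_addset A B h : {morph h : x y / x + y} -> continuous h ->
  closed A -> closed B ->
  (forall v, A v -> `|v| <= h v) -> (forall v, B v -> `|v| <= h v) ->
  closed [set a + b | a in A & b in B].
Proof.
move=> hD hc Acl Bcl Ah Bh p clp.
pose D X := X `&` [set v : 'rV[R]_k | `|v| <= h p + 1].
have Dcompact X : closed X -> compact (D X).
  move=> Xcl; apply: bounded_closed_compact.
    exists (h p + 1); split; first exact: num_real.
    by move=> c /ltW hc' v [_ /= vh]; exact: le_trans vh hc'.
  apply: closedI => //.
  have /continuous_closedP norm_closed := @norm_continuous R 'rV[R]_k.
  exact: (norm_closed _ (@closed_le R (h p + 1))).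
have : closed ((fun x : 'rV[R]_k * 'rV[R]_k => x.1 + x.2) @` (D A `*` D B)).
  apply: compact_closed; first exact: norm_hausdorff.
  apply: continuous_compact.
    by apply: continuous_subspaceT => x; exact: add_continuous.
  by apply: compact_setX; exact: Dcompact.
move=> /(_ p)[|[a b] [[/= Aa _] [Bb _]] <-]; last by exists a => //; exists b.
move=> U Up.
have : nbhs p (U `&` [set v | h v < h p + 1]).
  by apply: filterI => //; apply: (cvgr_lt (h p) (hc p)); rewrite ltrDl.
move=> /clp[_ [[a Aa [b Bb <-]] [Uab /= hab]]]; exists (a + b); split => //.
have := Ah _ Aa; have := Bh _ Bb; have := normr_ge0 a; have := normr_ge0 b.
rewrite hD in hab => b0 a0 bh ah.
by exists (a, b) => //; split; split => //=; lra.
Qed.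

Lemma conic_sum_pointed Q h m : h 0 = 0 -> {morph h : x y / x + y} ->
  (forall v, Q v -> `|v| <= h v) -> forall v, conic_sum Q m v -> `|v| <= h v.
Proof.
move=> h0 hD Qh; elim: m => [|m IH] v.
  by case=> f _ ->; rewrite big_ord0 normr0 h0.
rewrite conic_sumS => -[a Qa [b Qb <-]].
rewrite hD; apply: (le_trans (ler_normD _ _)).
by apply: lerD; [exact: IH|exact: Qh].
Qed.

Lemma closed_conic_sum Q h m : h 0 = 0 -> {morph h : x y / x + y} ->
  continuous h -> closed Q -> (forall v, Q v -> `|v| <= h v) ->
  closed (conic_sum Q m).
Proof.
move=> h0 hD hc Qcl Qh; elim: m => [|m IH].
  rewrite (_ : conic_sum Q 0 = [set 0]).
    by apply: compact_closed; [exact: norm_hausdorff|exact: compact_set1].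
  apply/seteqP; split=> v; first by case=> f _ ->; rewrite big_ord0.
  by move=> ->; exists (fun=> 0); [case|rewrite big_ord0].
rewrite conic_sumS; apply: (closed_addset hD hc IH Qcl _ Qh).
exact: (conic_sum_pointed h0 hD Qh).
Qed.

End conic_sums.

(** * The homogenised lift of the lattice points *)

Section lattice_cone.
Context {R : realType} {d : nat}.
Implicit Types (G C : set 'rV[R]_d) (u v : 'rV[R]_(1 + (1 + d))) (z : 'rV[R]_d).

(** Coordinates of the homogenised space: total mass, lifted height and first moment. Dividing the
    moment by the weight gives back a point of the original space. *)
Definition weight v : R := lsubmx v 0 0.
Definition height v : R := lsubmx (rsubmx v) 0 0.
Definition moment v : 'rV[R]_d := rsubmx (rsubmx v).

Lemma weightD : {morph weight : u v / u + v}.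
Proof. by move=> u v; rewrite /weight !mxE. Qed.

Lemma heightD : {morph height : u v / u + v}.
Proof. by move=> u v; rewrite /height !mxE. Qed.

Lemma momentD : {morph moment : u v / u + v}.
Proof. by move=> u v; rewrite /moment !linearD. Qed.

Lemma weightZ l v : weight (l *: v) = l * weight v.
Proof. by rewrite /weight !mxE. Qed.

Lemma heightZ l v : height (l *: v) = l * height v.
Proof. by rewrite /height !mxE. Qed.

Lemma momentZ l v : moment (l *: v) = l *: moment v.
Proof. by rewrite /moment !linearZ. Qed.

Lemma weight_continuous : continuous weight.
Proof.
move=> v; apply: (@continuous_comp _ _ _ lsubmx (fun M : 'rV[R]_1 => M 0 0)).
  exact: continuous_lsubmx.
exact: coord_continuous.
Qed.

Lemma height_continuous : continuous height.
Proof.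
move=> v; apply: (@continuous_comp _ _ _ rsubmx
  (fun u : 'rV[R]_(1 + d) => lsubmx u 0 0)).
  exact: continuous_rsubmx.
apply: (@continuous_comp _ _ _ lsubmx (fun M : 'rV[R]_1 => M 0 0)).
  exact: continuous_lsubmx.
exact: coord_continuous.
Qed.

Lemma moment_continuous : continuous moment.
Proof.
by move=> v; apply: (@continuous_comp _ _ _ rsubmx rsubmx);
  exact: continuous_rsubmx.
Qed.

(* The closure of the cone over [{(1, s, z) | z \in G, `|z|^2 <= s}]: the rays
   it adds have zero weight, and superlinear growth of [`|z|^2] forces their
   moment to vanish. *)
Definition lattice_cone G : set 'rV[R]_(1 + (1 + d)) :=
  [set v | [/\ 0 <= weight v, 0 <= height v,
               `|moment v| ^+ 2 <= weight v * height v &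
               0 < weight v -> G ((weight v)^-1 *: moment v)]].

Lemma lattice_coneZ G l v : 0 <= l -> lattice_cone G v -> lattice_cone G (l *: v).
Proof.
move=> l0 [w0 h0 mwh Gv]; split.
- by rewrite weightZ mulr_ge0.
- by rewrite heightZ mulr_ge0.
- rewrite weightZ heightZ momentZ normrZ ger0_norm// mulrACA -expr2 exprMn.
  by rewrite ler_wpM2l// exprn_ge0.
- rewrite weightZ momentZ; have [->|l_neq0] := eqVneq l 0.
    by rewrite mul0r ltxx.
  have l_gt0 : 0 < l by rewrite lt_def l_neq0.
  rewrite pmulr_rgt0// => wv.
  by rewrite scalerA invfM mulrAC mulVf// mul1r; exact: Gv.
Qed.

Lemma lattice_cone0 G : lattice_cone G 0.
Proof.
have w0 : weight 0 = 0 by rewrite /weight !mxE.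
have h0 : height 0 = 0 by rewrite /height !mxE.
have m0 : moment 0 = 0 by rewrite /moment !linear0.
by split; rewrite ?w0 ?h0 ?m0 ?normr0 ?expr0n ?mul0r ?ltxx.
Qed.

(** From [weight v * height v <= (weight v + height v) ^+ 2]. The linear form [weight + height] is
    thus the one that makes the cone pointed. *)
Lemma lattice_cone_norm G v : lattice_cone G v -> `|v| <= weight v + height v.
Proof.
move=> [w0 h0 mwh _]; apply: norm_submx_le.
  by apply: norm_row_le => [|i]; rewrite ?addr_ge0// ord1 ger0_norm// lerDl.
apply: norm_submx_le.
  by apply: norm_row_le => [|i]; rewrite ?addr_ge0// ord1 ger0_norm// lerDr.
rewrite -(@ler_pXn2r _ 2) ?nnegrE ?addr_ge0//.
by apply: le_trans mwh _; nra.
Qed.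

Lemma closed_lattice_cone G : closed G -> closed (lattice_cone G).
Proof.
move=> Gcl v clv.
have closed_ge0 (f : 'rV[R]_(1 + (1 + d)) -> R) : continuous f ->
    (forall u, lattice_cone G u -> 0 <= f u) -> 0 <= f v.
  move=> /continuous_closedP fc Gf.
  have fcl : closed (f @^-1` [set x | 0 <= x]) by apply: fc; exact: closed_ge.
  exact: (fcl v (closure_subset Gf clv)).
split.
- by apply: closed_ge0; [exact: weight_continuous|move=> u []].
- by apply: closed_ge0; [exact: height_continuous|move=> u []].
- rewrite -subr_ge0.
  apply: (closed_ge0 (fun u => weight u * height u - `|moment u| ^+ 2)).
    move=> u; apply: (@continuousB R R^o _ (weight \* height) (fun u => `|moment u| ^+ 2)).
      by apply: continuousM; [exact: weight_continuous|exact: height_continuous].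
    pose f u : R := `|moment u|.
    have fc : {for u, continuous f} by exact: (cvg_norm (@moment_continuous u)).
    exact: (@continuousM R _ f f).
  by move=> u [_ _ + _]; rewrite subr_ge0.
(* Positive weight is an open condition, and normalising the moment is continuous there, so
   membership in the closed set [G] passes to the limit. *)
move=> wv; apply: Gcl => U /= Uv.
have /clv[u [[_ _ _ Gu] [Uu wu]]] : nbhs v ((fun u =>
    (weight u)^-1 *: moment u) @^-1` U `&` [set u | 0 < weight u]).
  apply: filterI.
    have : {for v, continuous (fun u => (weight u)^-1 *: moment u)}.
      apply: continuousZ; last exact: moment_continuous.
      by apply: continuousV; [rewrite gt_eqF|exact: weight_continuous].
    exact.
  exact: (cvgr_gt (weight v) (@weight_continuous v)).
by exists ((weight u)^-1 *: moment u); split => //; exact: Gu.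
Qed.

(* A conic combination of weight 1 is a convex combination of points of [G]. *)
Lemma conic_sum_lattice_cone G C m v : G `<=` C -> convex_set C ->
  conic_sum (lattice_cone G) m v ->
  [/\ 0 <= weight v, weight v = 0 -> moment v = 0 &
      0 < weight v -> C ((weight v)^-1 *: moment v)].
Proof.
move=> GC /convex_setP cC; elim: m v => [|m IH] v.
  case=> f _ ->; rewrite big_ord0.
  have w0 : weight 0 = 0 by rewrite /weight !mxE.
  by rewrite w0 ltxx; split => // _; rewrite /moment !linear0.
rewrite conic_sumS => -[a /IH[wa0 ma Ca] [b [wb0 _ mb Gb] <-]].
(* At zero weight the quadratic bound makes the squared norm of the moment at most 0. *)
have mb0 : weight b = 0 -> moment b = 0.
  move=> wb; apply/eqP; move: mb; rewrite wb mul0r -normr_eq0.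
  by rewrite -[_ == 0](@sqrf_eq0 R) eq_le sqr_ge0 andbT.
rewrite weightD momentD; split; first exact: addr_ge0.
  by move=> /eqP; rewrite paddr_eq0// => /andP[/eqP/ma-> /eqP/mb0->]; rewrite addr0.
(* A term of zero weight has zero moment and drops out; it provides no point of [C]. *)
move=> w0; have [wa|wa] := eqVneq (weight a) 0.
  rewrite ma// wa !add0r; apply/GC/Gb.
  by move: w0; rewrite wa add0r.
have [wb|wb] := eqVneq (weight b) 0.
  by rewrite mb0// wb !addr0; apply/Ca; rewrite lt_def wa.
(* The normalised sum averages the two normalised points in proportion to their weights. *)
have := cC _ _ (weight a / (weight a + weight b)) _ (Ca _) (GC _ (Gb _)).
rewrite !lt_def wa wb wa0 wb0 => /(_ _ isT isT).
have -> : 1 - weight a / (weight a + weight b) = weight b / (weight a + weight b).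
  by field; rewrite gt_eqF.
rewrite !scalerA ![_ / (_ + _)]mulrC -!mulrA !divff// !mulr1 -scalerDr; apply.
rewrite mulr_ge0 ?invr_ge0 ?addr_ge0//=.
by rewrite mulrC ler_pdivrMr// mul1r lerDl.
Qed.

End lattice_cone.

Lemma conic_sum_sub (R : realType) k (Q : set 'rV[R]_k) m :
  Q 0 -> Q `<=` conic_sum Q m.+1.
Proof.
move=> Q0 v Qv; exists (fun i => if i == ord0 then v else 0) => [i|].
  by case: ifP.
by rewrite -big_mkcond big_pred1_eq.
Qed.

(** * The closed convex set that represents the union *)

Section mixed_integer_lift.
Context {R : realType} {n p d : nat}.
Variables (C : set 'rV[R]_d) (B : 'rV[R]_d -> set 'rV[R]_(n + p)).
Implicit Types v : 'rV[R]_(n + ((p + 1) + d)).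

(* [v] consists of [x], [(y, t)] and [z]. *)
Definition coord_xy v : 'rV[R]_(n + p) :=
  row_mx (lsubmx v) (lsubmx (lsubmx (rsubmx v))).
Definition coord_z v : 'rV[R]_d := rsubmx (rsubmx v).
(** Fixing the weight at 1 dehomogenises: the extra variable [t] becomes the height and [z] the
    moment. *)
Definition coord_1tz v : 'rV[R]_(1 + (1 + d)) :=
  row_mx (const_mx 1) (row_mx (rsubmx (lsubmx (rsubmx v))) (coord_z v)).

(** The number of terms is the dimension of the homogenised space, as Caratheodory requires for the
    sums to form a convex cone. *)
Definition mixed_integer_lift : set 'rV[R]_(n + ((p + 1) + d)) :=
  [set v | conic_sum (lattice_cone (C `&` int_lattice R d)) (1 + (1 + d))
             (coord_1tz v) /\ B (coord_z v) (coord_xy v)].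

Lemma coord_xy_continuous : continuous coord_xy.
Proof.
move=> v; apply: (@continuous_row_mx R); first exact: continuous_lsubmx.
apply: (@continuous_comp _ _ _ rsubmx (lsubmx \o lsubmx)).
  exact: continuous_rsubmx.
by apply: (@continuous_comp _ _ _ lsubmx lsubmx); exact: continuous_lsubmx.
Qed.

Lemma coord_z_continuous : continuous coord_z.
Proof.
by move=> v; apply: (@continuous_comp _ _ _ rsubmx rsubmx);
  exact: continuous_rsubmx.
Qed.

Lemma coord_1tz_continuous : continuous coord_1tz.
Proof.
move=> v; apply: (@continuous_row_mx R _ _ _ (fun=> const_mx 1)
  (fun u => row_mx (rsubmx (lsubmx (rsubmx u))) (coord_z u))).
  exact: cst_continuous.
apply: (@continuous_row_mx R); last exact: coord_z_continuous.
apply: (@continuous_comp _ _ _ rsubmx (rsubmx \o lsubmx)).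
  exact: continuous_rsubmx.
by apply: (@continuous_comp _ _ _ lsubmx rsubmx);
  [exact: continuous_lsubmx|exact: continuous_rsubmx].
Qed.

Lemma coord_1tz_conv l u v :
  coord_1tz (l *: u + (1 - l) *: v) =
  l *: coord_1tz u + (1 - l) *: coord_1tz v.
Proof.
rewrite /coord_1tz /coord_z !linearD !linearZ/= !scale_row_mx !add_row_mx.
by congr row_mx; apply/rowP => i; rewrite !mxE !mulr1 addrC subrK.
Qed.

(** At weight 1 the normalised moment is [z] itself, a convex combination of lattice points of
    [C]. *)
Lemma mixed_integer_lift_index v : convex_set C ->
  conic_sum (lattice_cone (C `&` int_lattice R d)) (1 + (1 + d)) (coord_1tz v) ->
  C (coord_z v).
Proof.
move=> cC /(conic_sum_lattice_cone (@subIsetl _ _ _) cC)[_ _].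
have -> : weight (coord_1tz v) = 1 by rewrite /weight row_mxKl mxE.
by rewrite /moment !row_mxKr invr1 scale1r; apply.
Qed.

Lemma convex_mixed_integer_lift : convex_set C -> convex_family C B ->
  convex_set mixed_integer_lift.
Proof.
move=> cC [_ cB]; apply/convex_setP => u v l l01 [Ku Bu] [Kv Bv].
have [l0 l1] := andP l01; split.
  have QZ := @lattice_coneZ R d (C `&` int_lattice R d).
  rewrite coord_1tz_conv.
  by apply: conic_sum_dimD => //; apply: conic_sumZ => //; rewrite subr_ge0.
have -> : coord_z (l *: u + (1 - l) *: v) = l *: coord_z u + (1 - l) *: coord_z v.
  by rewrite /coord_z !linearD !linearZ.
apply: (cB (coord_z u) (coord_z v)) => //; try exact: mixed_integer_lift_index.
exists (coord_xy u) => //; exists (coord_xy v) => //.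
by rewrite /coord_xy !linearD !linearZ/= !scale_row_mx !add_row_mx.
Qed.

(** The cone condition is closed by itself. It puts the limit index in [C], which is what the
    closedness of the family asks for before it applies. *)
Lemma closed_mixed_integer_lift : convex_set C -> closed_convex_family C B ->
  closed mixed_integer_lift.
Proof.
move=> cC [_ _ Bcl] v clv.
have [v_ Mv_ v_v] := closure_seq clv.
have Kv : conic_sum (lattice_cone (C `&` int_lattice R d)) (1 + (1 + d))
    (coord_1tz v).
  have Kcl : closed (conic_sum (lattice_cone (C `&` int_lattice R d)) (1 + (1 + d))).
    apply: (@closed_conic_sum _ _ _ (fun u => weight u + height u)).
    - by rewrite /weight /height !mxE addr0.
    - by move=> a b; rewrite weightD heightD addrACA.
    - move=> u; apply: (@continuousD R R^o _ weight height).
        exact: weight_continuous.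
      exact: height_continuous.
    - apply: closed_lattice_cone; apply: closed_sub_int_lattice.
      exact: subIsetr.
    - exact: lattice_cone_norm.
  have /continuous_closedP/(_ _ Kcl) liftcl := coord_1tz_continuous.
  by apply: (liftcl v); apply: closure_subset clv => u [].
split=> //; apply: (Bcl (coord_z \o v_) (coord_xy \o v_)).
- by move=> m; apply: mixed_integer_lift_index => //; have [] := Mv_ m.
- by move=> m; have [] := Mv_ m.
- by apply: cvg_comp v_v _; exact: coord_z_continuous.
- by apply: cvg_comp v_v _; exact: coord_xy_continuous.
- exact: mixed_integer_lift_index.
Qed.

Lemma proj_mixed_integer_lift : convex_set C ->
  proj_x (mixed_integer_lift `&` mixed_integer R n (p + 1) d) =
  \bigcup_(z in C `&` int_lattice R d) proj_x (B z).
Proof.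
move=> cC; apply/seteqP; split=> x.
  case=> v [[Kv Bv] Zv] <-; exists (coord_z v).
    by split => //; exact: mixed_integer_lift_index.
  by exists (coord_xy v) => //; rewrite row_mxKl.
case=> z [Cz Zz] [xy Bxy <-].
(* The least height allowed over [z]: with it the lifted point lies in the cone itself, as a sum
   with one nonzero term. *)
pose t : 'rV[R]_1 := const_mx (`|z| ^+ 2).
exists (row_mx (lsubmx xy) (row_mx (row_mx (rsubmx xy) t) z)); last first.
  by rewrite row_mxKl.
rewrite /mixed_integer_lift /mixed_integer /coord_1tz /coord_xy /coord_z /=.
rewrite !(row_mxKl, row_mxKr) hsubmxK; split=> //; split=> //.
apply: conic_sum_sub; first exact: lattice_cone0.
split; rewrite /weight /height /moment !(row_mxKl, row_mxKr) !mxE ?mul1r//.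
by rewrite invr1 scale1r.
Qed.

End mixed_integer_lift.

Theorem theorem1 (R : realType) (n : nat) (S : set 'rV[R]_n) :
  MICP_representable S <->
  exists (d p : nat) (C : set 'rV[R]_d) (B : 'rV[R]_d -> set 'rV[R]_(n + p)),
    [/\ convex_set C, closed_convex_family C B &
        S = \bigcup_(z in C `&` int_lattice R d) proj_x (B z)].
Proof.
split=> [[p [d [M [Mcl cM ->]]]]|[d [p [C [B [cC cB ->]]]]]]; last first.
  exists (p + 1)%N, d, (mixed_integer_lift C B); split.
  - exact: closed_mixed_integer_lift.
  - by apply: convex_mixed_integer_lift => //; case: cB.
  - by rewrite proj_mixed_integer_lift.
(* Conversely, the index set is the whole space and [B z] is the slice of [M] at [z]; [f] puts a
   slice point and its index back together. *)
pose f (z : 'rV[R]_d) (a : 'rV[R]_(n + p)) : 'rV[R]_(n + (p + d)) :=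
  row_mx (lsubmx a) (row_mx (rsubmx a) z).
have fD l z z' a a' : f (l *: z + (1 - l) *: z') (l *: a + (1 - l) *: a') =
    l *: f z a + (1 - l) *: f z' a'.
  by rewrite /f !linearD !linearZ/= !scale_row_mx !add_row_mx.
have fc (z_ : nat -> 'rV[R]_d) a_ z a : z_ @ \oo --> z -> a_ @ \oo --> a ->
    f (z_ m) (a_ m) @[m --> \oo] --> f z a.
  move=> z_z a_a; apply: cvg_row_mx.
    by apply: cvg_comp a_a _; exact: continuous_lsubmx.
  apply: cvg_row_mx => //.
  by apply: cvg_comp a_a _; exact: continuous_rsubmx.
have Mseq (z_ : nat -> 'rV[R]_d) a_ z a : (forall m, M (f (z_ m) (a_ m))) ->
    z_ @ \oo --> z -> a_ @ \oo --> a -> M (f z a).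
  move=> Mf z_z a_a; apply: closed_cvg Mcl _ _ (fc _ _ _ _ z_z a_a).
  exact: nearW.
move/convex_setP in cM.
have cB z z' l a a' : 0 <= l <= 1 -> M (f z a) -> M (f z' a') ->
    M (f (l *: z + (1 - l) *: z') (l *: a + (1 - l) *: a')).
  by move=> l01 Ma Ma'; rewrite fD; exact: cM.
exists d, p, setT, (fun z => [set a | M (f z a)]); split.
- exact/convex_setP.
- split; first split.
  + move=> z _; apply/convex_setP => a a' l l01 Ma Ma' /=.
    (* Convexity of one slice is the case of equal indices. *)
    have -> : z = l *: z + (1 - l) *: z by rewrite -scalerDl addrC subrK scale1r.
    exact: cB.
  + by move=> z z' l _ _ l01 _ [a Ma [a' Ma' <-]]; exact: cB.
  (* Closedness of one slice is the case of a constant index sequence. *)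
  + move=> z _ a /closure_seq[a_ Ma_ a_a].
    by apply: (Mseq (fun=> z) a_) => //; exact: cvg_cst.
  + by move=> z_ a_ z a _ Ma z_z a_a _; exact: Mseq z_z a_a.
- apply/seteqP; split=> x.
    case=> v [Mv Zv] <-; exists (rsubmx (rsubmx v)) => //.
    exists (row_mx (lsubmx v) (lsubmx (rsubmx v))); last by rewrite row_mxKl.
    by rewrite /= /f row_mxKl row_mxKr !hsubmxK.
  case=> z [_ Zz] [a Ma <-]; exists (f z a); last by rewrite row_mxKl.
  by split => //; rewrite /mixed_integer /= !row_mxKr.
Qed.
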